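(* Let $X$ be a finite-dimensional real normed space, let $(\phi_i)_{i=1}^n$ be a sequence of functionals of norm $1$ in $X^*$, let $(m_i)_{i=1}^n$ be a sequence of real numbers, and let $(w_i)_{i=1}^n$ be a sequence of positive numbers with $\sum_{i=1}^n w_i = 1$. Then there is a point $x$ in the (closed) unit ball of $X$ for which $$|\phi_i(x)-m_i|\ge w_i\quad\text{for every } i=1,\dots,n.$$
   Context: $X^*$ denotes the dual space of $X$ with its dual norm. *)

(* Defs.v *)
From HB Require Import structures.
From mathcomp Require Import all_boot all_order all_algebra.
From mathcomp Require Import all_classical all_reals all_analysis.
Set Implicit Arguments.
Unset Strict Implicit.
Unset Printing Implicit Defensive.
Import Order.TTheory GRing.Theory Num.Theory.
Import numFieldNormedType.Exports.
Local Open Scope classical_set_scope.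
Local Open Scope ring_scope.

(* The join of the two library structures: a Vector instance is a linear
   isomorphism with some 'rV[R]_d, so it expresses dim X < oo. *)
#[short(type="normedVectType")]
HB.structure Definition NormedVector (R : realType) :=
  {X of Vector R X & NormedModule R X}.

Definition dual_space (R : realType) (X : normedModType R) : set {scalar X} :=
  [set f : {scalar X} | continuous (f : X -> R)].
Arguments dual_space {R} X _.

(* The supremum is taken in R, so it is the operator norm only for bounded
   functionals; these are exactly the elements of dual_space X. *)
Definition dual_norm (R : realType) (X : normedModType R) (f : {scalar X}) : R :=
  sup [set `|f x| | x in [set x : X | `|x| <= 1]].

(* Main.v *)
Require Import Defs.
From HB Require Import structures.
From mathcomp Require Import all_boot all_order all_algebra.
From mathcomp Require Import all_classical all_reals all_analysis.
From mathcomp Require Import ring lra.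
Set Implicit Arguments.
Unset Strict Implicit.
Unset Printing Implicit Defensive.
Import Order.TTheory GRing.Theory Num.Theory.
Import numFieldNormedType.Exports.
Local Open Scope classical_set_scope.
Local Open Scope ring_scope.

(** The proof is K. Ball's.  Norm-one functionals attain their norm on the
    compact unit ball, so pick unit vectors [y j] with [phi j (y j) = 1] and look
    for [x] among the combinations [\sum_j lambda j *: y j] with
    [\sum_j |lambda j| <= 1].  Everything then depends only on the matrix
    [A i j = phi i (y j)], whose diagonal is 1: this is [plank_matrix].

    If [A] were symmetric, Bang's choice of signs ([bang_signs]) would suffice:
    for symmetric [H], a maximiser [mu] of a quadratic energy over all vectors
    [(+- c i)] satisfies [|(H mu) i - m i| >= H i i * |c i|].  In general, put
    [B i j = A i j * sqrt (w j)] and look for an orthogonal [U] and a row scaling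
    [theta] such that [H = diag(theta) B U] is symmetric positive semidefinite
    with diagonal [w] ([orthogonal_scaling]).  Apply Bang's lemma to [H] with
    [c = theta] and targets [theta i * m i], divide row [i] by [theta i], and set
    [lambda j = sqrt (w j) * (U mu) j].  The distance in row [i] is at least
    [w i].  Since [\sum_i w i = 1], the l1 bound on [lambda] follows once
    [\sum_i theta i ^ 2 <= 1], and that is the trace inequality
    [sum_diag_psd_orthogonal] for [H] and [U^T]: [H U^T] has diagonal
    [theta i * sqrt (w i)], and [tr H = 1].

    The matrix [U] is a maximiser of [\prod_i |(B U) i i| ^ (w i)] over the compact
    orthogonal group, and [theta i = w i / (B U) i i].  Comparing [U] with its
    products by Householder reflections gives both properties of [H].  A
    reflection along a vector close to a coordinate vector gives the first-order
    condition, which is the symmetry of [H].  A reflection along an eigenvector of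
    [H] with a negative eigenvalue would decrease no factor of the product and
    increase at least one, so there is no such eigenvector. *)

(** * Quadratic forms, orthogonal matrices and the Euclidean norm *)

Section BilinearForm.
Variables (R : realFieldType) (n : nat).
Implicit Types (H Q : 'M[R]_n) (u v : 'rV[R]_n).

Definition bform H u v : R := (u *m H *m v^T) 0 0.

Definition psd H := forall v, 0 <= bform H v v.

Definition orthogonal Q := Q *m Q^T = 1%:M.

Lemma bformDl H u1 u2 v : bform H (u1 + u2) v = bform H u1 v + bform H u2 v.
Proof. by rewrite /bform !mulmxDl mxE. Qed.

Lemma bformZl H a u v : bform H (a *: u) v = a * bform H u v.
Proof. by rewrite /bform -!scalemxAl mxE. Qed.

Lemma bformC H u v : H^T = H -> bform H u v = bform H v u.
Proof.
move=> Hsym; rewrite /bform -[in LHS]Hsym -[LHS]trace_mx11 -mxtrace_tr.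
by rewrite !trmx_mul !trmxK trace_mx11 mulmxA.
Qed.

Lemma bformE H u v : bform H u v = \sum_i u 0 i * \sum_j H i j * v 0 j.
Proof.
rewrite /bform -mulmxA mxE; apply: eq_bigr => i _; congr (_ * _).
by rewrite mxE; apply: eq_bigr => j _; rewrite mxE.
Qed.

Lemma bform_deltal H i v : bform H (delta_mx 0 i) v = \sum_j H i j * v 0 j.
Proof.
by rewrite /bform -rowE mxE; apply: eq_bigr => j _; rewrite !mxE.
Qed.

Lemma bform_delta H i j : bform H (delta_mx 0 i) (delta_mx 0 j) = H i j.
Proof.
rewrite bform_deltal (bigD1 j)//= big1 => [|k kj]; rewrite !mxE !eqxx/=.
  by rewrite mulr1 addr0.
by rewrite (negbTE kj) mulr0.
Qed.

Lemma bformZ H a v : bform H (a *: v) (a *: v) = a ^+ 2 * bform H v v.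
Proof. by rewrite /bform -!scalemxAl linearZ/= -scalemxAr !mxE mulrA. Qed.

Lemma bform_polar H a u v : H^T = H ->
  bform H (u + a *: v) (u + a *: v) =
  bform H u u + 2 * a * bform H u v + a ^+ 2 * bform H v v.
Proof.
move=> Hsym; rewrite bformDl !(bformC _ (u + _)) // !bformDl !bformZl.
rewrite !(bformC _ (_ *: _)) // !bformZl (bformC v u)//; ring.
Qed.

Lemma orthogonalM Q1 Q2 : orthogonal Q1 -> orthogonal Q2 -> orthogonal (Q1 *m Q2).
Proof.
rewrite /orthogonal => o1 o2.
by rewrite trmx_mul mulmxA -(mulmxA Q1) o2 mulmx1.
Qed.

Lemma orthogonal_tr Q : orthogonal Q -> orthogonal Q^T.
Proof. by rewrite /orthogonal trmxK; exact: mulmx1C. Qed.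

End BilinearForm.

Section SquaredNorm.
Variables (R : realFieldType) (n : nat).
Implicit Types v : 'rV[R]_n.

Definition sqnorm v := \sum_i v 0 i ^+ 2.

Lemma sqnormE v : v *m v^T = (sqnorm v)%:M.
Proof.
by rewrite [LHS]mx11_scalar mxE; congr _%:M; apply: eq_bigr => i _; rewrite mxE.
Qed.

Lemma sqnorm_gt0 v : v != 0 -> 0 < sqnorm v.
Proof.
case/rV0Pn => i vi; rewrite /sqnorm (bigD1 i)//= ltr_wpDr ?sumr_ge0//.
  by move=> j _; exact: sqr_ge0.
by rewrite lt_neqAle sqr_ge0 eq_sym expf_neq0.
Qed.

Lemma sqnorm0 : sqnorm (0 : 'rV[R]_n) = 0.
Proof. by rewrite /sqnorm big1// => i _; rewrite mxE expr0n. Qed.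

Lemma sqnorm_mul_orthogonal v Q :
  orthogonal Q -> sqnorm (v *m Q) = sqnorm v.
Proof.
move=> oQ; have : (v *m Q) *m (v *m Q)^T = v *m v^T.
  by rewrite trmx_mul mulmxA -(mulmxA v) oQ mulmx1.
by rewrite !sqnormE => /matrixP/(_ 0 0); rewrite !mxE eqxx.
Qed.

End SquaredNorm.

Lemma sqnorm_normalize (R : rcfType) n (v : 'rV[R]_n) :
  v != 0 -> sqnorm ((Num.sqrt (sqnorm v))^-1 *: v) = 1.
Proof.
move=> /sqnorm_gt0 v0; rewrite {1}/sqnorm.
under eq_bigr do rewrite mxE exprMn.
by rewrite -mulr_sumr exprVn sqr_sqrtr ?ltW// mulVf// lt0r_neq0.
Qed.

(** * Bang's choice of signs *)

(** At a maximiser of the energy [mu H mu^T - 2 mu m^T] over all sign choices,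
    flipping the sign of the single coordinate [k] does not increase it, which
    reads [mu k * ((H mu) k - m k) >= H k k * mu k ^ 2].  Maximising, and not
    minimising, is what pushes [H mu] away from [m]. *)
Lemma bang_signs (R : realFieldType) n (H : 'M[R]_n) (c m : 'I_n -> R) :
  H^T = H ->
  exists mu : 'rV[R]_n, (forall i, mu 0 i = c i \/ mu 0 i = - c i) /\
    forall i, H i i * `|c i| <= `|\sum_j H i j * mu 0 j - m i|.
Proof.
move=> Hsym.
pose x (s : {ffun 'I_n -> bool}) : 'rV[R]_n := \row_i (if s i then c i else - c i).
pose E v := bform H v v - 2 * \sum_i v 0 i * m i.
pose s := [arg max_(s > [ffun=> true] : {ffun 'I_n -> bool}) E (x s)]%O.
have Emax t : E (x t) <= E (x s) by rewrite /s; case: arg_maxP => //= s' _; apply.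
exists (x s); split=> [i|k]; first by rewrite mxE; case: ifP; [left|right].
pose t := [ffun i => (i == k) (+) s i].
have xtE : x t = x s + (- (2 * x s 0 k)) *: delta_mx 0 k.
  apply/rowP => i; rewrite !mxE ffunE eqxx/=; have [->|ik] := eqVneq i k.
    by case: (s k) => /=; ring.
  by rewrite /= mulr0 addr0.
have sumE : \sum_i x t 0 i * m i = \sum_i x s 0 i * m i - 2 * x s 0 k * m k.
  suff <- : \sum_i (x s 0 i * m i - x t 0 i * m i) = 2 * x s 0 k * m k.
    by rewrite sumrB; ring.
  rewrite (bigD1 k)//= big1 => [|i ik]; rewrite xtE !mxE eqxx/=.
    by rewrite eqxx/=; ring.
  by rewrite (negbTE ik)/=; ring.
have := Emax t; rewrite /E sumE xtE bform_polar// bform_delta bformC//.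
rewrite bform_deltal; set S := \sum_j H k j * _; set y := x s 0 k.
move=> le_E.
have {le_E} le_y : y ^+ 2 * H k k <= y * (S - m k) by nra.
have ->: `|c k| = `|y| by rewrite /y mxE; case: ifP => //; rewrite normrN.
have [->|y0] := eqVneq y 0; first by rewrite normr0 mulr0.
rewrite -(ler_pM2l (_ : 0 < `|y|)) ?normr_gt0// -normrM.
rewrite (le_trans _ (ler_norm _))// (le_trans _ le_y)//.
by rewrite -[y ^+ 2]real_normK ?num_real// expr2; lra.
Qed.

(** * Positive semidefinite matrices *)

Lemma psd_cauchy_schwarz (R : realFieldType) n (H : 'M[R]_n) u v :
  H^T = H -> psd H -> 0 < bform H u u ->
  bform H u v ^+ 2 / bform H u u <= bform H v v.
Proof.
move=> Hsym Hpsd u0; have := Hpsd (v + (- (bform H u v / bform H u u)) *: u).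
rewrite bform_polar// (bformC v u)// => /le_trans h; rewrite -subr_ge0; apply: h.
by rewrite le_eqVlt; apply/orP; left; apply/eqP; field; rewrite gt_eqF.
Qed.

(** Entry [(i, i)] of [H V] is the value of the form [H] at the [i]-th coordinate
    vector and the [i]-th column of [V].  Cauchy-Schwarz bounds its square by
    [H i i * (V^T H V) i i], and [V^T H V] has the same trace as [H]. *)
Lemma sum_diag_psd_orthogonal (R : realFieldType) n (H V : 'M[R]_n) :
  H^T = H -> psd H -> (forall i, 0 < H i i) -> orthogonal V ->
  \sum_i (H *m V) i i ^+ 2 / H i i <= \sum_i H i i.
Proof.
move=> Hsym Hpsd H0 oV.
have -> : \sum_i H i i = \sum_i bform H (row i V^T) (row i V^T).
  rewrite -[LHS]/(\tr H) -[H in LHS]mulmx1 -oV mulmxA mxtrace_mulC mulmxA.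
  apply: eq_bigr => i _; rewrite /bform tr_row trmxK -row_mul [LHS]mxE [RHS]mxE.
  by apply: eq_bigr => j _; rewrite !mxE.
apply: ler_sum => i _.
have -> : (H *m V) i i = bform H (delta_mx 0 i) (row i V^T).
  by rewrite bform_deltal mxE; apply: eq_bigr => j _; rewrite !mxE.
by rewrite -[X in _ / X]bform_delta psd_cauchy_schwarz// bform_delta.
Qed.

(** Otherwise the form would be affine and nonconstant, hence somewhere
    negative, on the line through [v] in the direction [u]. *)
Lemma psd_isotropic (R : realFieldType) n (H : 'M[R]_n) u v :
  H^T = H -> psd H -> bform H u u = 0 -> bform H v u = 0.
Proof.
move=> Hsym Hpsd u0; apply/eqP; apply: contraT => b0.
(* the affine function takes the value -1 at the chosen point *)
have := Hpsd (v + (- ((bform H v v + 1) / (2 * bform H v u))) *: u).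
rewrite bform_polar// u0 mulr0 addr0.
set b := bform H v u in b0 *; set c := bform H v v.
have -> : c + 2 * - ((c + 1) / (2 * b)) * b = - 1 by field.
by rewrite ler0N1.
Qed.

(** * Householder reflections *)

Section Householder.
Variables (R : realFieldType) (n : nat).
Implicit Types (H : 'M[R]_n) (v : 'rV[R]_n).

Definition reflection v : 'M[R]_n := 1%:M - (2 / sqnorm v) *: (v^T *m v).

Lemma orthogonal_reflection v : v != 0 -> orthogonal (reflection v).
Proof.
move=> v0; have symR : (reflection v)^T = reflection v.
  by rewrite /reflection linearB/= [(_ *: _)^T]linearZ/= trmx_mul trmxK trmx1.
rewrite /orthogonal symR /reflection.
rewrite mulmxBl mul1mx mulmxBr mulmx1 -scalemxAl -scalemxAr.
rewrite mulmxA -(mulmxA _ v) sqnormE mul_mx_scalar -scalemxAl !scalerA.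
have -> : 2 / sqnorm v * (2 / sqnorm v * sqnorm v) = 2 / sqnorm v + 2 / sqnorm v.
  by field; rewrite gt_eqF ?sqnorm_gt0.
by rewrite scalerDl opprB addrK subrK.
Qed.

Lemma diag_mul_reflection H v i :
  (H *m reflection v) i i = H i i - 2 / sqnorm v * (v 0 i * \sum_j H i j * v 0 j).
Proof.
rewrite /reflection mulmxBr mulmx1 -scalemxAr mulmxA 4!mxE big_ord1.
rewrite [v 0 i * _]mulrC; congr (_ - _ * (_ * _)).
by rewrite mxE; apply: eq_bigr => j _; rewrite mxE.
Qed.

End Householder.

(** * The Euclidean sphere and negative eigenvectors *)

Section RealAnalysis.
Variable R : realType.

Lemma continuous_sum (T : topologicalType) (I : Type) (r : seq I) (F : I -> T -> R) :
  (forall i, continuous (F i)) -> continuous (fun x => \sum_(i <- r) F i x).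
Proof. by move=> cF; apply: continuous_big => //; exact: add_continuous. Qed.

Lemma continuous_prod (T : topologicalType) (I : Type) (r : seq I) (F : I -> T -> R) :
  (forall i, continuous (F i)) -> continuous (fun x => \prod_(i <- r) F i x).
Proof. by move=> cF; apply: continuous_big => //; exact: mul_continuous. Qed.

Lemma rV_norm_le n (u : 'rV[R]_n) (M : R) :
  0 <= M -> (forall i, `|u 0 i| <= M) -> `|u| <= M.
Proof.
move=> M0 uM; rewrite [leLHS]mx_normrE; apply: bigmax_le => // -[i j] _ /=.
by rewrite ord1.
Qed.

Lemma rV_norm_le_sqnorm n (v : 'rV[R]_n) : `|v| <= Num.sqrt (sqnorm v).
Proof.
apply: rV_norm_le => [|i]; first exact: sqrtr_ge0.
rewrite -sqrtr_sqr ler_wsqrtr// /sqnorm (bigD1 i)//= lerDl sumr_ge0// => j _.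
exact: sqr_ge0.
Qed.

Lemma continuous_sqnorm n : continuous (@sqnorm R n).
Proof.
apply: continuous_sum => i u; apply: continuousM; exact: coord_continuous.
Qed.

Lemma sphere_compact n : compact [set u : 'rV[R]_n | sqnorm u = 1].
Proof.
apply: bounded_closed_compact.
  exists 1; split; first exact: num_real.
  move=> M M1 u /= u1; apply: le_trans (rV_norm_le_sqnorm u) _.
  by rewrite u1 sqrtr1 ltW.
rewrite [X in closed X](_ : _ = @sqnorm R n @^-1` [set 1])//.
apply: preimage_closed => [u _|]; [exact: continuous_sqnorm|exact: closed_eq].
Qed.

Lemma continuous_bform n (H : 'M[R]_n) : continuous (fun u => bform H u u).
Proof.
under eq_fun do rewrite bformE.
apply: continuous_sum => i u; apply: continuousM; first exact: coord_continuous.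
apply: continuous_sum => j {}u; apply: continuousM; first exact: cst_continuous.
exact: coord_continuous.
Qed.

(** The Rayleigh quotient attains its minimum [l] on the sphere at some [u].  Then
    [H - l] is positive semidefinite and isotropic at [u], so [u] lies in its
    kernel. *)
Lemma negative_eigenvector n (H : 'M[R]_n) v : H^T = H -> bform H v v < 0 ->
  exists2 u : 'rV[R]_n, u != 0 &
    exists2 l, l < 0 & forall i, \sum_j H i j * u 0 j = l * u 0 i.
Proof.
move=> Hsym Hv.
pose S := [set u : 'rV[R]_n | sqnorm u = 1].
have bform0 K : bform (K : 'M[R]_n) 0 0 = 0 by rewrite /bform mul0mx mul0mx mxE.
have v0 : v != 0 by apply/eqP => ve; move: Hv; rewrite ve bform0 ltxx.
have [u uS umin] : exists2 u, u \in S & forall w, w \in S -> bform H u u <= bform H w w.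
  apply: compact_EVT_min; [by eexists; exact: sqnorm_normalize v0|exact: sphere_compact|].
  exact/continuous_subspaceT/continuous_bform.
rewrite inE /S/= in uS.
pose l := bform H u u.
have lmin w : l * sqnorm w <= bform H w w.
  have [->|w0] := eqVneq w 0.
    by rewrite bform0 sqnorm0 mulr0.
  have := umin _ (mem_set (sqnorm_normalize w0 : S _)).
  rewrite bformZ exprVn sqr_sqrtr; last exact/ltW/sqnorm_gt0.
  by rewrite ler_pdivlMl ?sqnorm_gt0// mulrC.
have l0 : l < 0 by have := lmin v; have := sqnorm_gt0 v0; nra.
pose K := H - l%:M.
have KE x y : bform K x y = bform H x y - l * (x *m y^T) 0 0.
  by rewrite /bform /K mulmxBr mulmxBl mul_mx_scalar -scalemxAl !mxE.
have Ksym : K^T = K by rewrite /K linearB/= tr_scalar_mx Hsym.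
have Kpsd : psd K by move=> w; rewrite KE sqnormE mxE eqxx mulr1n subr_ge0.
have Ku : bform K u u = 0 by rewrite KE sqnormE uS mxE eqxx mulr1 subrr.
exists u; first by apply/eqP => ue; move: l0; rewrite /l ue bform0 ltxx.
exists l => // i; apply/eqP; rewrite -subr_eq0.
have := psd_isotropic (delta_mx 0 i) Ksym Kpsd Ku.
by rewrite KE bform_deltal -rowE !mxE => ->.
Qed.

End RealAnalysis.

(** * Matrices whose diagonal product is maximal under rotation *)

Section DiagMaximal.
Variables (R : realType) (n : nat).
Implicit Types (H Q : 'M[R]_n) (v : 'rV[R]_n).

(** The identity maximises [Q |-> \prod_i |(H Q) i i| ^ (H i i)] over orthogonal
    matrices.  In logarithmic form the matrices [Q] for which the product vanishes
    have to be excluded, since [ln 0 = 0]. *)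
Definition diag_maximal H := forall Q, orthogonal Q ->
  (forall i, (H *m Q) i i != 0) ->
  \sum_i H i i * ln `|(H *m Q) i i| <= \sum_i H i i * ln (H i i).

(** The factor by which the reflection along [v] multiplies the [i]-th diagonal
    entry of [H]. *)
Definition reflection_ratio H v i :=
  1 - 2 / sqnorm v * (v 0 i * \sum_j H i j * v 0 j) / H i i.

Lemma diag_maximal_reflection H v : (forall i, 0 < H i i) -> diag_maximal H ->
  v != 0 -> (forall i, reflection_ratio H v i != 0) ->
  \sum_i H i i * ln `|reflection_ratio H v i| <= 0.
Proof.
move=> H0 Hmax v0 r0.
have diagE i : (H *m reflection v) i i = H i i * reflection_ratio H v i.
  rewrite diag_mul_reflection /reflection_ratio; field.
  by rewrite !lt0r_neq0 ?sqnorm_gt0.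
have nz i : (H *m reflection v) i i != 0.
  by rewrite diagE mulf_neq0 ?(lt0r_neq0 (H0 i)).
have := Hmax _ (orthogonal_reflection v0) nz.
rewrite -subr_le0 -sumrB.
rewrite (eq_bigr (fun i => H i i * ln `|reflection_ratio H v i|))// => i _.
rewrite diagE normrM gtr0_norm// lnM ?posrE ?normr_gt0//; ring.
Qed.

Lemma ln_ge1V (y : R) : 0 < y -> 1 - y^-1 <= ln y.
Proof.
move=> y0; have := @le_ln1Dx R (y^-1 - 1); rewrite [1 + _]addrC subrK lnV ?posrE//.
by rewrite ltrBDr addNr invr_gt0 => /(_ y0); lra.
Qed.

(** Reflecting along [e_p + t e_q] is, up to the sign of one column, a rotation of
    the plane of [p] and [q] by an angle of order [t]: it moves the logarithm of
    the diagonal product by [2 t (H p q - H q p)] to first order.  Only small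
    [t > 0] are used, so one inequality results; exchanging [p] and [q] gives the
    other. *)
Lemma diag_maximal_le H p q : (forall i, 0 < H i i) -> diag_maximal H ->
  p != q -> H p q <= H q p.
Proof.
move=> H0 Hmax pq.
set P := H p p; set Q := H q q.
have P0 : 0 < P by exact: H0.
have Q0 : 0 < Q by exact: H0.
(* [y1] and [y2] are the factors of the diagonal entries [p] (up to sign) and
   [q], times [1 + t ^ 2]; the lower bound that [ln_ge1V] provides for the growth
   of the logarithm of the product is [- g] up to a positive factor *)
pose y1 : {poly R} := 1 + (2 * H p q / P) *: 'X - 'X^2.
pose y2 : {poly R} := 1 - (2 * H q p / Q) *: 'X - 'X^2.
pose g : {poly R} := ((H q p)%:P + Q *: 'X) * y1 - ((H p q)%:P - P *: 'X) * y2.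
have y1E t : y1.[t] = 1 + 2 * H p q / P * t - t ^+ 2 by rewrite /y1 !hornerE.
have y2E t : y2.[t] = 1 - 2 * H q p / Q * t - t ^+ 2 by rewrite /y2 !hornerE.
have gE t : g.[t] = (H q p + Q * t) * y1.[t] - (H p q - P * t) * y2.[t].
  by rewrite /g !hornerE.
have near_pos (r : {poly R}) : r.[0] = 1 -> \forall t \near 0^'+, 0 < r.[t].
  move=> r0; apply: (cvgr_gt r.[0]); last by rewrite r0.
  by apply: cvg_at_right_filter; exact: continuous_horner.
suff : 0 <= g.[0] by rewrite gE y1E y2E; lra.
have g0 : g.[t] @[t --> 0^'+] --> g.[0].
  by apply: cvg_at_right_filter; exact: continuous_horner.
apply: (cvgr_to_ge g0); near=> t.
have t0 : 0 < t by near: t; exact: nbhs_right_gt.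
have y1t : 0 < y1.[t] by near: t; apply: near_pos; rewrite y1E; lra.
have y2t : 0 < y2.[t] by near: t; apply: near_pos; rewrite y2E; lra.
pose v : 'rV[R]_n := delta_mx 0 p + t *: delta_mx 0 q.
have qp : q != p by rewrite eq_sym.
have vp : v 0 p = 1 by rewrite !mxE !eqxx (negbTE pq)/=; ring.
have vq : v 0 q = t by rewrite !mxE !eqxx (negbTE qp)/=; ring.
have vE i : i != p -> i != q -> v 0 i = 0.
  by move=> ip iq; rewrite !mxE (negbTE ip) (negbTE iq) andbF/=; ring.
have v0 : v != 0 by apply/rV0Pn; exists p; rewrite vp oner_eq0.
have sum2 (F : 'I_n -> R) : (forall i, i != p -> i != q -> F i = 0) ->
    \sum_i F i = F p + F q.
  move=> F0; rewrite (bigD1 p)//= (bigD1 q)//= big1 ?addr0// => i /andP[].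
  exact: F0.
have Nv : sqnorm v = 1 + t ^+ 2.
  rewrite /sqnorm sum2 ?vp ?vq ?expr1n// => i ip iq.
  by rewrite vE// expr0n.
have Hv i : \sum_j H i j * v 0 j = H i p + t * H i q.
  by rewrite sum2 ?vp ?vq ?mulr1 1?[t * _]mulrC// => j jp jq; rewrite vE// mulr0.
have N0 : 0 < 1 + t ^+ 2 by rewrite -Nv sqnorm_gt0.
have rp : reflection_ratio H v p = - (y1.[t] / (1 + t ^+ 2)).
  rewrite /reflection_ratio Nv Hv vp y1E -/P; field.
  by rewrite !lt0r_neq0.
have rq : reflection_ratio H v q = y2.[t] / (1 + t ^+ 2).
  rewrite /reflection_ratio Nv Hv vq y2E -/Q; field.
  by rewrite !lt0r_neq0.
have ri i : i != p -> i != q -> reflection_ratio H v i = 1.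
  by move=> ip iq; rewrite /reflection_ratio vE// !(mul0r, mulr0) subr0.
have y1N : 0 < y1.[t] / (1 + t ^+ 2) by rewrite divr_gt0.
have y2N : 0 < y2.[t] / (1 + t ^+ 2) by rewrite divr_gt0.
have r0 i : reflection_ratio H v i != 0.
  have [->|ip] := eqVneq i p; first by rewrite rp oppr_eq0 lt0r_neq0.
  have [->|iq] := eqVneq i q; first by rewrite rq lt0r_neq0.
  by rewrite ri// oner_eq0.
have := diag_maximal_reflection H0 Hmax v0 r0.
rewrite sum2 => [|i ip iq]; last by rewrite ri// normr1 ln1 mulr0.
rewrite rp rq normrN !gtr0_norm// -/P -/Q => le0.
have := ln_ge1V y1N; rewrite -(ler_pM2l P0) => le1.
have := ln_ge1V y2N; rewrite -(ler_pM2l Q0) => le2.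
have : P * (1 - (y1.[t] / (1 + t ^+ 2))^-1) +
       Q * (1 - (y2.[t] / (1 + t ^+ 2))^-1) <= 0 by lra.
have -> : P * (1 - (y1.[t] / (1 + t ^+ 2))^-1) +
          Q * (1 - (y2.[t] / (1 + t ^+ 2))^-1) =
          - (2 * t / y1.[t] / y2.[t] * g.[t]).
  have e1 : P * (y1.[t] - (1 + t ^+ 2)) = 2 * t * (H p q - P * t).
    by rewrite y1E; field; rewrite lt0r_neq0.
  have e2 : Q * (y2.[t] - (1 + t ^+ 2)) = - (2 * t * (H q p + Q * t)).
    by rewrite y2E; field; rewrite lt0r_neq0.
  rewrite gE !invfM !invrK.
  transitivity (P * (y1.[t] - (1 + t ^+ 2)) / y1.[t] +
                Q * (y2.[t] - (1 + t ^+ 2)) / y2.[t]).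
    by field; rewrite !lt0r_neq0.
  by rewrite e1 e2; field; rewrite !lt0r_neq0.
by rewrite oppr_le0 pmulr_rge0// !divr_gt0// mulr_gt0.
Unshelve. all: by end_near. Qed.

Lemma diag_maximal_sym H : (forall i, 0 < H i i) -> diag_maximal H -> H^T = H.
Proof.
move=> H0 Hmax; apply/matrixP => i j; rewrite mxE.
have [->//|ij] := eqVneq i j.
by apply/eqP; rewrite eq_le !diag_maximal_le// eq_sym.
Qed.

(** Reflecting along an eigenvector [u] with eigenvalue [l < 0] multiplies the
    [i]-th diagonal entry by [1 - 2 l u_i^2 / (|u|^2 H i i) >= 1], strictly where
    [u_i != 0], which contradicts maximality. *)
Lemma diag_maximal_psd H : (forall i, 0 < H i i) -> diag_maximal H -> psd H.
Proof.
move=> H0 Hmax v; rewrite leNgt; apply/negP => Hv.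
have v0 : v != 0.
  by apply/eqP => ve; move: Hv; rewrite ve /bform !mul0mx mxE ltxx.
have [u u0 [l l0 eig]] := negative_eigenvector (diag_maximal_sym H0 Hmax) Hv.
pose d i := - 2 * l / sqnorm u / H i i * u 0 i ^+ 2.
have rE i : reflection_ratio H u i = 1 + d i.
  by rewrite /reflection_ratio eig /d; field; rewrite !lt0r_neq0 ?sqnorm_gt0.
have c0 i : 0 < - 2 * l / sqnorm u / H i i.
  by rewrite !divr_gt0 ?sqnorm_gt0//; nra.
have d0 i : 0 <= d i by rewrite mulr_ge0 ?sqr_ge0// ltW.
have r1 i : 1 <= reflection_ratio H u i by rewrite rE lerDl.
have r0 i : reflection_ratio H u i != 0 := lt0r_neq0 (lt_le_trans ltr01 (r1 i)).
have := diag_maximal_reflection H0 Hmax u0 r0.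
apply/negP; rewrite -ltNge.
have /rV0Pn[i ui] := u0.
have ln_ge j : 0 <= H j j * ln `|reflection_ratio H u j|.
  by rewrite mulr_ge0 ?(ltW (H0 j))// ln_ge0// ger0_norm// (le_trans ler01).
rewrite (bigD1 i)//= ltr_wpDr ?sumr_ge0//.
rewrite mulr_gt0// ln_gt0// ger0_norm ?(le_trans ler01)// rE ltrDl mulr_gt0//.
by rewrite lt_neqAle sqr_ge0 eq_sym expf_neq0.
Qed.

End DiagMaximal.

(** * Making a matrix symmetric positive by row scaling and rotation *)

Section OrthogonalScaling.
Variables (R : realType) (n : nat).

(** The objective of the maximisation may vanish at some orthogonal matrices,
    so continuity is needed at 0 too. *)
Lemma powR_norm_continuous (a : R) : 0 < a -> continuous (fun x : R => `|x| `^ a).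
Proof.
move=> a0 x; have [->|x0] := eqVneq x 0.
  rewrite /continuous_at normr0 powR0 ?lt0r_neq0//.
  apply/cvgrPdist_lt => e e0; near=> y.
  rewrite sub0r normrN ger0_norm ?powR_ge0//.
  have -> : e = (e `^ a^-1) `^ a by rewrite -powRrM mulVf ?lt0r_neq0// powRr1// ltW.
  apply: gt0_ltr_powR => //; rewrite ?nnegrE ?powR_ge0 ?normr_ge0//.
  rewrite -[y]subr0 distrC; near: y.
  by apply: (@cvgr_dist_lt _ _ _ _ _ id 0) => //; rewrite powR_gt0.
apply: (@continuous_comp _ _ _ (fun x : R => `|x|) (fun y => y `^ a)).
  exact: norm_continuous.
apply/differentiable_continuous/derivable1_diffP/derivable_powR.
by rewrite in_itv/= andbT normr_gt0.
Unshelve. all: by end_near. Qed.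

(** Closed bounded sets are known to be compact for row vectors; matrices are
    therefore parametrised by [vec_mx]. *)
Lemma continuous_vec_mx i j : continuous (fun u : 'rV[R]_(n * n) => vec_mx u i j : R).
Proof. by under eq_fun do rewrite mxE; exact: coord_continuous. Qed.

Lemma orthogonal_entry_sum (Q : 'M[R]_n) i j :
  (Q *m Q^T) i j = \sum_k Q i k * Q j k.
Proof. by rewrite mxE; apply: eq_bigr => k _; rewrite mxE. Qed.

Lemma orthogonal_compact :
  compact [set u : 'rV[R]_(n * n) | orthogonal (vec_mx u : 'M[R]_n)].
Proof.
apply: bounded_closed_compact.
  exists 1; split; first exact: num_real.
  move=> M M1 u /= ou; apply: rV_norm_le => [|ij].
    by rewrite ltW// (lt_trans ltr01).
  case/mxvec_indexP: ij => i j.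
  rewrite -[u]vec_mxK mxvecE.
  set Q := vec_mx u in ou *.
  have : (Q *m Q^T) i i = 1 by rewrite ou mxE eqxx.
  rewrite orthogonal_entry_sum => Q1.
  rewrite (le_trans _ (ltW M1))// -sqrtr_sqr -sqrtr1 ler_sqrt// -Q1.
  by rewrite (bigD1 j)//= -expr2 lerDl sumr_ge0// => k _; exact: sqr_ge0.
pose g (ij : 'I_n * 'I_n) (u : 'rV[R]_(n * n)) :=
  \sum_k vec_mx u ij.1 k * vec_mx u ij.2 k : R.
rewrite [X in closed X](_ : _ =
  \bigcap_(ij in [set: 'I_n * 'I_n]) (g ij @^-1` [set (ij.1 == ij.2)%:R])).
  apply: closed_bigI => ij _; apply: preimage_closed => [u _|]; last exact: closed_eq.
  apply: continuous_sum => k {}u; apply: continuousM; exact: continuous_vec_mx.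
apply/seteqP; split=> u /=.
  by move=> ou ij _ /=; rewrite /g -orthogonal_entry_sum ou mxE.
move=> ou; apply/matrixP => i j.
by rewrite orthogonal_entry_sum [LHS](ou (i, j))// mxE.
Qed.

(** Let [U] maximise [\prod_i |(B U) i i| ^ (w i)].  The value at the identity is
    nonzero, so no [(B U) i i] vanishes and the rows of [B U] can be scaled to get
    the diagonal [w].  Scaling the rows multiplies the product by a constant, so
    the scaled matrix is [diag_maximal]; this requires the exponents to equal the
    new diagonal. *)
Lemma orthogonal_scaling (B : 'M[R]_n) (w : 'I_n -> R) :
  (forall i, B i i != 0) -> (forall i, 0 < w i) ->
  exists U (theta : 'I_n -> R),
    let H := \matrix_(i, j) (theta i * (B *m U) i j) in
    [/\ orthogonal U, forall i, theta i != 0, forall i, H i i = w i, H^T = H & psd H].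
Proof.
move=> B0 w0.
pose f (Q : 'M[R]_n) := \prod_i `|(B *m Q) i i| `^ w i.
have fE Q : (forall i, (B *m Q) i i != 0) ->
    f Q = expR (\sum_i w i * ln `|(B *m Q) i i|).
  move=> Q0; rewrite expR_sum; apply: eq_bigr => i _.
  by rewrite /powR normr_eq0 (negbTE (Q0 i)).
have orth1 : orthogonal (1%:M : 'M[R]_n) by rewrite /orthogonal trmx1 mulmx1.
have cB i : continuous (fun u : 'rV[R]_(n * n) => (B *m vec_mx u) i i : R).
  under eq_fun do rewrite mxE.
  apply: continuous_sum => k u; apply: continuousM; first exact: cst_continuous.
  exact: continuous_vec_mx.
pose O := [set u : 'rV[R]_(n * n) | orthogonal (vec_mx u : 'M[R]_n)].
have [u] : exists2 u, u \in O & forall v, v \in O -> f (vec_mx v) <= f (vec_mx u).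
  apply: compact_EVT_max; [|exact: orthogonal_compact|].
    by exists (mxvec 1%:M); rewrite /O /= mxvecK.
  apply: continuous_subspaceT; apply: continuous_prod => i u.
  apply: (@continuous_comp _ _ _ (fun u => (B *m vec_mx u) i i) (fun y => `|y| `^ w i)).
    exact: cB.
  exact: powR_norm_continuous.
rewrite inE /=; set U := vec_mx u => oU Umax.
have {}Umax Q : orthogonal Q -> f Q <= f U.
  by move=> oQ; rewrite -[Q]mxvecK; apply: Umax; rewrite inE /O /= mxvecK.
have U0 i : (B *m U) i i != 0.
  apply/eqP => Ui; have := Umax _ orth1.
  rewrite fE => [|j]; last by rewrite mulmx1.
  rewrite /f [leRHS](bigD1 i)//= Ui normr0 powR0 ?lt0r_neq0// mul0r.
  by rewrite leNgt expR_gt0.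
pose theta i := w i / (B *m U) i i.
have t0 i : theta i != 0 by rewrite mulf_neq0 ?invr_eq0 ?(lt0r_neq0 (w0 i)).
exists U, theta; set H := \matrix_(i, j) _; rewrite /=.
have HE Q i j : (H *m Q) i j = theta i * (B *m (U *m Q)) i j.
  rewrite mulmxA !mxE mulr_sumr; apply: eq_bigr => k _.
  by rewrite mxE mulrA.
have Hd i : H i i = w i by rewrite mxE divfK.
have H0 i : 0 < H i i by rewrite Hd.
have HdU i : ln (H i i) = ln `|theta i * (B *m U) i i|.
  by rewrite -[in LHS](gtr0_norm (H0 i)) mxE.
have Hmax : diag_maximal H.
  move=> Q oQ Q0.
  have Q0' i : (B *m (U *m Q)) i i != 0.
    by have := Q0 i; rewrite HE mulf_eq0 negb_or => /andP[].
  have := Umax _ (orthogonalM oU oQ); rewrite !fE// ler_expR => le_sum.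
  rewrite -(lerD2r (- \sum_i w i * ln `|theta i|)) -!sumrB.
  have lnE x i : x != 0 ->
      w i * ln `|theta i * x| - w i * ln `|theta i| = w i * ln `|x|.
    by move=> x0; rewrite normrM lnM ?posrE ?normr_gt0//; ring.
  rewrite (eq_bigr (fun i => w i * ln `|(B *m (U *m Q)) i i|)) => [|i _].
    rewrite [leRHS](eq_bigr (fun i => w i * ln `|(B *m U) i i|))// => i _.
    by rewrite HdU Hd lnE.
  by rewrite Hd HE lnE.
by split=> //; [exact: diag_maximal_sym|exact: diag_maximal_psd].
Qed.

End OrthogonalScaling.

(** * The plank theorem for matrices *)

(** The columns are weighted by [sqrt (w j)] because the vectors [lambda] with
    [\sum_j lambda j ^ 2 / w j <= 1] form an ellipsoid inside the l1 ball
    ([\sum_j w j = 1]), and an orthogonal change of variables respects the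
    ellipsoid, although not the l1 ball. *)
Lemma plank_matrix (R : realType) n (A : 'M[R]_n) (m w : 'I_n -> R) :
  (forall i, A i i = 1) -> (forall i, 0 < w i) -> \sum_i w i = 1 ->
  exists2 lambda : 'I_n -> R, \sum_j `|lambda j| <= 1 &
    forall i, w i <= `|\sum_j A i j * lambda j - m i|.
Proof.
move=> A1 w0 w1.
pose B := \matrix_(i, j) (A i j * Num.sqrt (w j)).
have Bd i : B i i = Num.sqrt (w i) by rewrite mxE A1 mul1r.
have B0 i : B i i != 0 by rewrite Bd lt0r_neq0// sqrtr_gt0.
have [U [theta []]] := orthogonal_scaling B0 w0.
set H := \matrix_(i, j) _ => oU t0 Hd Hsym Hpsd.
have theta1 : \sum_i theta i ^+ 2 <= 1.
  have H0 i : 0 < H i i by rewrite Hd.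
  have := sum_diag_psd_orthogonal Hsym Hpsd H0 (orthogonal_tr oU).
  rewrite [leRHS](eq_bigr w)// w1; apply: le_trans; rewrite le_eqVlt; apply/orP; left.
  apply/eqP/eq_bigr => i _.
  have -> : (H *m U^T) i i = theta i * B i i.
    rewrite -[B]mulmx1 -oU mulmxA !mxE mulr_sumr.
    by apply: eq_bigr => k _; rewrite [H _ _]mxE mulrA.
  by rewrite Bd Hd exprMn sqr_sqrtr ?mulfK// ?lt0r_neq0// ltW.
have [mu [mu_c mu_bang]] := bang_signs theta (fun i => theta i * m i) Hsym.
pose nu := mu *m U^T.
have nu1 : sqnorm nu <= 1.
  rewrite sqnorm_mul_orthogonal; last exact: orthogonal_tr.
  rewrite (le_trans _ theta1)// ler_sum// => i _.
  by case: (mu_c i) => ->; rewrite ?sqrrN.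
exists (fun j => Num.sqrt (w j) * nu 0 j) => [|i].
  rewrite (@le_trans _ _ (\sum_j (w j + nu 0 j ^+ 2) / 2))//; last first.
    by rewrite -mulr_suml big_split/= w1; move: nu1; rewrite /sqnorm; lra.
  (* [sqrt w * |nu| <= (w + nu ^ 2) / 2], termwise *)
  apply: ler_sum => j _; rewrite normrM ger0_norm ?sqrtr_ge0//.
  have := sqr_ge0 (Num.sqrt (w j) - `|nu 0 j|).
  by rewrite sqrrB (sqr_sqrtr (ltW (w0 j))) real_normK ?num_real//; lra.
have := mu_bang i; rewrite Hd mulrC.
have -> : \sum_j H i j * mu 0 j = theta i * \sum_j A i j * (Num.sqrt (w j) * nu 0 j).
  transitivity (theta i * (B *m (U *m mu^T)) i 0).
    rewrite mulmxA mxE mulr_sumr; apply: eq_bigr => j _.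
    by rewrite [H _ _]mxE [mu^T _ _]mxE mulrA.
  congr (_ * _); rewrite mxE; apply: eq_bigr => j _.
  by rewrite -[U]trmxK -trmx_mul [_^T _ _]mxE [B _ _]mxE mulrA.
by rewrite -mulrBr normrM ler_pM2l// normr_gt0.
Qed.

(** * Finite-dimensional normed spaces *)

Section NormedVect.
Import VectorInternalTheory.
Variables (R : realType) (X : normedVectType R).

Lemma r2v_continuous : continuous (r2v : 'rV[R]_(dim X) -> X).
Proof.
have -> : (r2v : 'rV[R]_(dim X) -> X) =
    fun u => \sum_j u 0 j *: (r2v (delta_mx 0 j) : X).
  apply/funext => u; rewrite {1}[u]row_sum_delta linear_sum.
  by apply: eq_bigr => j _; rewrite linearZ.
apply: continuous_big => [|j _ u]; first exact: add_continuous.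
exact: (cvgZr_tmp (@coord_continuous R 1 (dim X) 0 j u)).
Qed.

(** The norm pulled back to coordinates by [r2v] has a positive minimum [c] on the
    Euclidean sphere, so the coordinates of the unit ball are bounded by [1 / c]. *)
Lemma unit_ball_compact : compact [set x : X | `|x| <= 1].
Proof.
pose K := [set u : 'rV[R]_(dim X) | `|(r2v u : X)| <= 1].
have cnorm : continuous (fun u : 'rV[R]_(dim X) => `|(r2v u : X)|).
  move=> u; apply: (@continuous_comp _ _ _ (r2v : 'rV[R]_(dim X) -> X) (fun y => `|y|)).
    exact: r2v_continuous.
  exact: norm_continuous.
have -> : [set x : X | `|x| <= 1] = r2v @` K.
  apply/seteqP; split=> [x /= x1|_ [u /= u1 <-]//].
  by exists (v2r x); rewrite /K/= v2rK.
apply: continuous_compact; first exact/continuous_subspaceT/r2v_continuous.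
apply: bounded_closed_compact; last first.
  rewrite [X in closed X](_ : _ = (fun u => `|(r2v u : X)|) @^-1` [set y | y <= 1])//.
  by apply: preimage_closed => [u _|]; [exact: cnorm|exact: closed_le].
have [c c0 cS] : exists2 c, 0 < c &
    forall u : 'rV[R]_(dim X), sqnorm u = 1 -> c <= `|(r2v u : X)|.
  (* the sphere is empty in dimension 0 *)
  have [[u0 u0S]|noS] := pselect ([set u : 'rV[R]_(dim X) | sqnorm u = 1] !=set0);
      last first.
    by exists 1 => // u u1; case: noS; exists u.
  have [u] := compact_EVT_min (ex_intro _ u0 u0S) (@sphere_compact _ _)
    (continuous_subspaceT cnorm).
  rewrite inE /= => u1 umin; exists `|(r2v u : X)|; last first.
    by move=> v v1; apply: umin; rewrite inE.
  rewrite normr_gt0; apply/eqP => /(congr1 (@v2r _ X)); rewrite r2vK linear0 => ue.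
  by move: u1; rewrite ue sqnorm0 => /eqP; rewrite eq_sym oner_eq0.
exists c^-1; split; first exact: num_real.
move=> M cM u; rewrite /K/= => u1; apply: le_trans (ltW cM).
have [->|u0] := eqVneq u 0; first by rewrite normr0 invr_ge0 ltW.
apply: le_trans (rV_norm_le_sqnorm _) _.
have N0 : 0 < Num.sqrt (sqnorm u) by rewrite sqrtr_gt0 sqnorm_gt0.
have := cS _ (sqnorm_normalize u0).
rewrite linearZ/= normrZ ger0_norm ?invr_ge0 ?(ltW N0)// ler_pdivlMl// => cu.
by rewrite -[leRHS]mulr1 ler_pdivlMl// mulrC (le_trans cu).
Qed.

Lemma dual_norm_attained (phi : {scalar X}) :
  dual_space X phi -> exists2 x : X, `|x| <= 1 & phi x = dual_norm phi.
Proof.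
move=> cphi.
have [x] : exists2 x, x \in [set x : X | `|x| <= 1] &
    forall y, y \in [set x : X | `|x| <= 1] -> `|phi y| <= `|phi x|.
  apply: compact_EVT_max; [by exists 0; rewrite /= normr0|exact: unit_ball_compact|].
  apply: continuous_subspaceT => x.
  apply: (@continuous_comp _ _ _ (phi : X -> R) (fun y => `|y|)); first exact: cphi.
  exact: norm_continuous.
rewrite inE /= => x1 xmax.
have -> : dual_norm phi = `|phi x|.
  apply/eqP; rewrite eq_le; apply/andP; split.
    apply: ge_sup; first by exists `|phi x|, x.
    by move=> _ [y /= y1 <-]; apply: xmax; rewrite inE.
  apply: sup_upper_bound; last by exists x.
  split; first by exists `|phi x|, x.
  by exists `|phi x| => _ [y /= y1 <-]; apply: xmax; rewrite inE.
have [p0|p0] := leP 0 (phi x); first by exists x; rewrite ?ger0_norm.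
by exists (- x); rewrite ?normrN// linearN ltr0_norm.
Qed.

End NormedVect.

(** * The plank theorem *)

Theorem theorem2 (R : realType) (X : normedVectType R) (n : nat)
    (phi : 'I_n -> {scalar X}) (m w : 'I_n -> R)
    (phi_dual : forall i, dual_space X (phi i))
    (phi_norm1 : forall i, dual_norm (phi i) = 1)
    (w_gt0 : forall i, 0 < w i)
    (w_sum1 : \sum_(i < n) w i = 1) :
  exists x : X, `|x| <= 1 /\ forall i, w i <= `|phi i x - m i|.
Proof.
have /choice[y yP] : forall i, exists y : X, `|y| <= 1 /\ phi i y = 1.
  move=> i; have [y y1] := dual_norm_attained (phi_dual i).
  by rewrite phi_norm1; exists y.
pose A := \matrix_(i, j) phi i (y j).
have A1 i : A i i = 1 by rewrite mxE; have [] := yP i.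
have [lambda l1 lP] := plank_matrix m A1 w_gt0 w_sum1.
exists (\sum_j lambda j *: y j); split.
  rewrite (le_trans (ler_norm_sum _ _ _))// (le_trans _ l1)// ler_sum// => j _.
  by rewrite normrZ ler_piMr//; have [] := yP j.
move=> i; rewrite linear_sum/= (eq_bigr (fun j => A i j * lambda j))// => j _.
by rewrite linearZ/= mxE mulrC.
Qed.
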